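(* Let $\big(\mathbf X^h(\cdot,t),\mu^h(\cdot,t)\big)\in\mathbb X_p^h\times\mathbb K_p^h$, $t\ge0$, be a solution of the semi-discretization $$\big(\partial_t\mathbf X^h,\varphi^h\mathbf n^h\big)^h_{\Gamma^h(t)}+\big(\partial_s\mu^h,\partial_s\varphi^h\big)^h_{\Gamma^h(t)}=0\quad\forall\varphi^h\in\mathbb K_p^h,$$ $$\big(\mu^h,\mathbf n^h\cdot\boldsymbol\omega^h\big)^h_{\Gamma^h(t)}-\big(G(\theta^h)\partial_s\mathbf X^h,\partial_s\boldsymbol\omega^h\big)^h_{\Gamma^h(t)}=0\quad\forall\boldsymbol\omega^h\in\mathbb X_p^h,$$ with initial data $\mathbf X^h(\rho_j,0)=\mathbf X_0(s_j^0)$, $s_j^0=L_0\rho_j$, $j=0,1,\dots,N$. Define $$A^h(t)=\frac12\sum_{j=1}^N(x_j(t)-x_{j-1}(t))(y_j(t)+y_{j-1}(t)),\qquad W_c^h(t)=\sum_{j=1}^N|\mathbf h_j(t)|\,\gamma(\theta_j^h(t)),$$ where $(x_j(t),y_j(t))^T=\mathbf X^h(\rho_j,t)$. Then the area/mass is conserved, $$A^h(t)\equiv A^h(0)=\frac12\sum_{j=1}^N[x_0(s_j^0)-x_0(s_{j-1}^0)][y_0(s_j^0)+y_0(s_{j-1}^0)],\qquad t\ge0,$$ and the total interfacial energy is dissipative, $$W_c^h(t)\le W_c^h(t_1)\le W_c^h(0)=\sum_{j=1}^N|\mathbf h_j(0)|\,\gamma(\theta_j^h(0)),\qquad t\ge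 t_1\ge0.$$
   Context: The surface energy $\gamma\in C^1([-\pi,\pi])$ is positive and periodic: $\gamma(-\pi)=\gamma(\pi)$, $\gamma'(-\pi)=\gamma'(\pi)$. $G(\theta)=\begin{pmatrix}\gamma(\theta)&-\gamma'(\theta)\\ \gamma'(\theta)&\gamma(\theta)\end{pmatrix}$. For $\mathbf v=(v_1,v_2)^T$, $\mathbf v^\perp=(v_2,-v_1)^T$. Let $N>2$ be an integer, $h=1/N$, $\rho_j=jh$ ($0\le j\le N$), $I_j=[\rho_{j-1},\rho_j]$. $\mathbb K_p^h$ is the space of continuous functions $u^h$ on $[0,1]$ which are affine on each $I_j$ and satisfy $u^h(0)=u^h(1)$; $\mathbb X_p^h=\mathbb K_p^h\times\mathbb K_p^h$. The initial closed curve is $\mathbf X_0(s)=(x_0(s),y_0(s))^T$, $0\le s\le L_0$, with $\mathbf X_0(0)=\mathbf X_0(L_0)$. The polygonal curve $\Gamma^h(t)$ is given by $\mathbf X^h(\cdot,t)\in\mathbb X_p^h$, differentiable in $t$, with $\mathbf h_j(t)=(h_{j,x},h_{j,y})^T=\mathbf X^h(\rho_j,t)-\mathbf X^h(\rho_{j-1},t)$; it is assumed that $\min_j|\mathbf h_j(t)|>0$ for all $t\ge0$. On $I_j$ the normal is the constant $\mathbf n^h_j=-\mathbf h_j^\perp/|\mathbf h_j|$, and the angle $\theta^h|_{I_j}=\theta_j^h\in[-\pi,\pi]$ satisfies $\cos\theta_j^h=h_{j,x}/|\mathbf h_j|$, $\sin\theta_j^h=h_{j,y}/|\mathbf h_j|$.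 For a function $f$ affine on each $I_j$, $\partial_s f|_{I_j}=\big(f(\rho_j)-f(\rho_{j-1})\big)/|\mathbf h_j(t)|$. The mass-lumped inner product of piecewise linear scalar- or vector-valued functions (possibly with jumps at the nodes) is $(u,v)^h_{\Gamma^h(t)}=\frac12\sum_{j=1}^N|\mathbf h_j(t)|\big[(u\cdot v)(\rho_j^-)+(u\cdot v)(\rho_{j-1}^+)\big]$, with one-sided limits at the nodes. *)

(* Defs.v *)
From mathcomp Require Import all_boot all_order all_algebra.
From mathcomp Require Import all_classical all_reals all_analysis.

Set Implicit Arguments.
Unset Strict Implicit.
Unset Printing Implicit Defensive.

Import Order.TTheory GRing.Theory Num.Theory.
Import numFieldNormedType.Exports.

Local Open Scope classical_set_scope.
Local Open Scope ring_scope.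

Section Derivative.
Variables (R : realType) (V : normedModType R).

(** Derivatives relative to a set [D]: at an endpoint of an interval they are
    one-sided, and the values of [f] outside [D] play no role. *)
Definition diff_quot (f : R -> V) (t : R) : R -> V :=
  fun s => (s - t)^-1 *: (f s - f t).

Definition derivable_within (D : set R) (f : R -> V) (t : R) : Prop :=
  cvg (diff_quot f t @ within D t^').

Definition derive_within (D : set R) (f : R -> V) (t : R) : V :=
  lim (diff_quot f t @ within D t^').

End Derivative.

Definition C1_on (R : realType) (a b : R) (f : R -> R) : Prop :=
  (forall x, x \in `[a, b] -> derivable_within `[a, b] f x) /\
  {within `[a, b], continuous (derive_within `[a, b] f)}.

Section Plane.
Variable R : realType.
Implicit Types u v : 'cV[R]_2.

Definition vec2 (x y : R) : 'cV[R]_2 := \col_i (if i == 0 then x else y).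

Definition dot u v : R := \sum_i u i 0 * v i 0.

(* The library norm on matrices is the sup norm, hence this definition. *)
Definition enorm v : R := Num.sqrt (dot v v).

Definition perp v : 'cV[R]_2 := vec2 (v 1 0) (- v 0 0).

Definition Gmat (gamma : R -> R) (theta : R) : 'M[R]_2 :=
  let dgamma := derive_within `[- pi, pi] gamma in
  \matrix_(i, j) (if i == j then gamma theta
                  else if (i < j)%N then - dgamma theta else dgamma theta).

End Plane.

Section FiniteElements.
Variables (R : realType) (N : nat).

Definition node (j : nat) : R := j%:R / N%:R.

(** Functions on [[0, 1]] are represented by functions on [R], whose values
    outside [[0, 1]] are never used. *)
Definition Khp (u : R -> R) : Prop :=
  [/\ {within `[0, 1], continuous u},
      forall j, (1 <= j <= N)%N -> exists a b : R,
        forall r, r \in `[node j.-1, node j] -> u r = a * r + b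
    & u 0 = u 1].

Definition Xhp (w : R -> 'cV[R]_2) : Prop :=
  forall i, Khp (fun r => w r i 0).

(** The function equal to [c j] on the [j]-th element, [1 <= j <= N]. The value
    chosen at the nodes is immaterial: only one-sided limits are used there. *)
Definition pwconst (T : Type) (c : nat -> T) (r : R) : T :=
  c (Num.truncn (N%:R * r)).+1.

(** In the definitions below [len j] is the length of the [j]-th edge. *)
Definition ds (V : lmodType R) (len : nat -> R) (f : R -> V) : R -> V :=
  pwconst (fun j => (len j)^-1 *: (f (node j) - f (node j.-1))).

Definition lumped (len : nat -> R) (p : R -> R) : R :=
  2^-1 * \sum_(1 <= j < N.+1)
    len j * (lim (p r @[r --> (node j)^'-]) + lim (p r @[r --> (node j.-1)^'+])).

Definition lumped_scal (len : nat -> R) (u v : R -> R) : R :=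
  lumped len (fun r => u r * v r).

Definition lumped_vec (len : nat -> R) (u v : R -> 'cV[R]_2) : R :=
  lumped len (fun r => dot (u r) (v r)).

Section Polygon.
Variable X : R -> 'cV[R]_2.

Definition edge (j : nat) : 'cV[R]_2 := X (node j) - X (node j.-1).

Definition edge_len (j : nat) : R := enorm (edge j).

Definition normal (j : nat) : 'cV[R]_2 := - ((edge_len j)^-1 *: perp (edge j)).

Definition is_angle (j : nat) (theta : R) : Prop :=
  [/\ theta \in `[- pi, pi],
      cos theta = edge j 0 0 / edge_len j
    & sin theta = edge j 1 0 / edge_len j].

Definition area : R :=
  2^-1 * \sum_(1 <= j < N.+1)
    (X (node j) 0 0 - X (node j.-1) 0 0) * (X (node j) 1 0 + X (node j.-1) 1 0).

Definition energy (gamma : R -> R) (theta : nat -> R) : R :=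
  \sum_(1 <= j < N.+1) edge_len j * gamma (theta j).

End Polygon.

(** The two equations of the semi-discrete scheme at one time: [dX] is the time
    derivative of [X], and [theta j] the angle of the [j]-th edge of [X]. *)
Definition semi_discrete (gamma : R -> R) (X dX : R -> 'cV[R]_2) (mu : R -> R)
    (theta : nat -> R) : Prop :=
  let len := edge_len X in
  let n := pwconst (normal X) in
  (forall phi, Khp phi ->
     lumped_vec len dX (fun r => phi r *: n r)
     + lumped_scal len (ds len mu) (ds len phi) = 0) /\
  (forall w, Xhp w ->
     lumped_scal len mu (fun r => dot (n r) (w r))
     - lumped_vec len (fun r => pwconst (fun j => Gmat gamma (theta j)) r *m ds len X r)
         (ds len w) = 0).

End FiniteElements.

(* Main.v *)
Require Import Defs.
From mathcomp Require Import all_boot all_order all_algebra.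
From mathcomp Require Import all_classical all_reals all_analysis.
From mathcomp Require Import ring lra.
Import Order.TTheory GRing.Theory Num.Theory.
Import numFieldNormedType.Exports.
Local Open Scope classical_set_scope.
Local Open Scope ring_scope.

(** Both laws come from a choice of test functions in the scheme, compared with
    the time derivatives of the area and of the energy.

    With [phi = 1] the term in [mu] drops out, and the first equation says that
    the velocity has zero total flux through the polygon. By summation by parts
    around the closed polygon this flux is the time derivative of the area
    ([scheme_flux_eq0], [has_derive_within_area]).

    With [phi = mu] and [w] the velocity [V] of the curve, the two equations
    share the term [(mu, n . V)]; eliminating it leaves
    [(G(theta) d_s X, d_s V) = - (d_s mu, d_s mu) <= 0] ([scheme_dissipation]).
    The velocity is an admissible test function because interpolation between
    the nodes is linear with coefficients independent of time, so that it
    commutes with time derivatives ([Khp_derive]). The left-hand side is the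
    time derivative of the energy ([has_derive_within_energy]): an edge [h] of
    angle [theta] satisfies [|h|' = h . h' / |h|] and
    [theta' = cross h h' / |h|^2], hence
    [(|h| gamma(theta))' = (gamma(theta) h . h' + gamma'(theta) cross h h') / |h|],
    and this is [G(theta) (h / |h|) . h'].

    Two difficulties are analytic. First, the angle is confined to [[-pi, pi]]
    and jumps when an edge turns through the direction [-pi = pi], so the chain
    rule does not apply to [gamma(theta)] directly. As the values and the
    derivatives of [gamma] match at both ends, its periodic extension is
    differentiable at every point of [[-pi, pi]] ([is_derive_wrap_angle]); and
    near a given time the angle can be replaced by the differentiable one
    obtained by adding to its current value the arctangent of the rotation since
    then, which has the same sine and cosine ([has_derive_within_edge_energy]).
    Second, time starts at [0], where derivatives are one-sided: functions of
    time are extended affinely to negative times, after which the two-sided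
    calculus applies at [0] as well ([is_derive_extend_left]). *)

(** * One-sided derivatives *)

(** The value of the derivative is carried along, as in [is_derive]: the limits
    are then computed by unification and [derive_within] need not be evaluated. *)
Definition has_derive_within {R : realType} (D : set R) (f : R -> R) (t l : R) :=
  diff_quot f t @ within D t^' --> l.

(** [is_derive] refers to quotients in the increment, [diff_quot] to quotients in
    the moving point; Caratheodory's criterion does not see the difference. *)
Lemma is_derive_quotP {R : realType} (f : R -> R) (t l : R) :
  is_derive t 1 f l <-> diff_quot f t @ t^' --> l.
Proof.
rewrite is_derive1_caratheodory; split=> [[g [fE gc <-]]|ql].
  have := continuous_withinNx g t; case=> /(_ gc) {}gc _.
  apply: cvg_trans gc; apply: near_eq_cvg; near=> s.
  rewrite /diff_quot fE /GRing.scale /= [RHS]mulrC mulfK//.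
  rewrite subr_eq0; near: s; exact: nbhs_dnbhs_neq.
exists (fun z => if z == t then l else diff_quot f t z); split.
- move=> z; case: eqVneq => [->|zt]; first by rewrite !subrr mulr0.
  by rewrite /diff_quot /GRing.scale /= mulrC mulVKf// subr_eq0.
- apply/continuous_withinNx; rewrite eqxx; apply: cvg_trans ql.
  apply: near_eq_cvg; near=> s; rewrite ifF//; apply/negbTE.
  by near: s; exact: nbhs_dnbhs_neq.
- by rewrite eqxx.
Unshelve. all: by end_near. Qed.

(** The way back from one-sided to two-sided derivatives; it matters at time [0]
    and at the angles [-pi] and [pi]. *)
Lemma is_derive_glue {R : realType} (D1 D2 : set R) (f : R -> R) (t l : R) :
  has_derive_within D1 f t l -> has_derive_within D2 f t l ->
  (\forall s \near t, D1 s \/ D2 s) -> is_derive t 1 f l.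
Proof.
move=> h1 h2 h12; apply/is_derive_quotP => A Al.
have {}h1 := h1 _ Al; have {}h2 := h2 _ Al.
rewrite /= /nbhs /= /within /= in h1 h2 *.
have h3 : \forall s \near t^', D1 s \/ D2 s by exact: cvg_within h12.
by apply: filterS3 h1 h2 h3 => s a1 a2 [/a1|/a2].
Qed.

Lemma has_derive_within_congr {R : realType} (D : set R) (f g : R -> R) (t l : R) :
  has_derive_within D g t l -> f t = g t ->
  (\forall s \near t, D s -> f s = g s) -> has_derive_within D f t l.
Proof.
move=> gl ft fg; apply: (cvg_trans _ gl).
apply: near_eq_cvg; rewrite near_withinE.
have {}fg : \forall s \near t^', D s -> f s = g s by exact: cvg_within fg.
by apply: filterS fg => s fg Ds; rewrite /diff_quot fg// ft.
Qed.

Lemma has_derive_within_is_derive {R : realType} (D : set R) (f : R -> R) (t l : R) :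
  is_derive t 1 f l -> has_derive_within D f t l.
Proof. by move=> /is_derive_quotP fl; exact: cvg_within_filter. Qed.

Lemma has_derive_within_shift {R : realType} (D : set R) (f : R -> R) (c t l : R) :
  has_derive_within D f (t - c) l ->
  has_derive_within [set s | D (s - c)] (fun s => f (s - c)) t l.
Proof.
move=> fl A Al.
have {}fl : \forall s \near t - c, s != t - c -> D s -> A (diff_quot f (t - c) s).
  exact: fl.
have shiftc : (fun s : R => s - c) @ t --> t - c by apply: cvgB => //; exact: cvg_cst.
suff : \forall s \near t, s != t -> D (s - c) -> A (diff_quot (fun s => f (s - c)) t s).
  by [].
have {}fl : \forall s \near t, s - c != t - c -> D (s - c) -> A (diff_quot f (t - c) (s - c)).
  exact: (shiftc _ fl).
apply: filterS fl => s /= fA st Ds; move: fA; rewrite /diff_quot.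
rewrite (_ : s - c - (t - c) = s - t); last by ring.
by apply => //; apply: contra st => /eqP/addIr ->.
Qed.

Lemma derivable_within_has_derive {R : realType} (D : set R) (f : R -> R) (t : R) :
  derivable_within D f t -> has_derive_within D f t (derive_within D f t).
Proof. by []. Qed.

(** With [l] the right derivative of [f] at [0], continuing [f] by its tangent
    line turns one-sided differentiability at [0] into differentiability. *)
Definition extend_left {R : realType} (f : R -> R) (l s : R) : R :=
  if s < 0 then f 0 + s * l else f s.

Lemma extend_leftE {R : realType} (f : R -> R) (l s : R) :
  0 <= s -> extend_left f l s = f s.
Proof. by rewrite /extend_left ltNge => ->. Qed.

(** At [0] the right derivative of [f] and the slope [l0] of the line have to
    agree; at positive times [f] itself is differentiable, since a neighbourhood
    of the point lies in the half-line. *)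
Lemma is_derive_extend_left {R : realType} (f : R -> R) (l0 t l : R) :
  0 <= t -> (t = 0 -> l = l0) -> has_derive_within `[0, +oo[ f t l ->
  is_derive t 1 (extend_left f l0) l.
Proof.
move=> t0 l0E fl.
have fr : has_derive_within `[0, +oo[ (extend_left f l0) t l.
  apply: (has_derive_within_congr _ _ _ _ _ fl); first by rewrite extend_leftE.
  by near=> s; rewrite /= in_itv/= andbT => s0; rewrite extend_leftE.
move: t0; rewrite le_eqVlt => /predU1P[t0|t0].
  apply: (is_derive_glue `[0, +oo[ `]-oo, 0] _ _ _ fr).
    apply: (@has_derive_within_congr _ _ _ (fun s => f 0 + s * l0)).
    - apply: has_derive_within_is_derive; rewrite l0E// ; apply: is_derive_eq.
      by rewrite /GRing.scale /=; lra.
    - by rewrite -t0 extend_leftE// mul0r addr0.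
    - near=> s; rewrite /= in_itv/= le_eqVlt => /predU1P[->|s0].
        by rewrite extend_leftE// mul0r addr0.
      by rewrite /extend_left s0.
  near=> s; rewrite /= !in_itv/= andbT; exact/orP/le_total.
apply: (is_derive_glue _ _ _ _ _ fr fr); near=> s; left.
by rewrite /= in_itv/= andbT; apply: ltW; near: s; exact: lt_nbhsr.
Unshelve. all: by end_near. Qed.

(** Monotonicity starting at time [0] itself: the extension is differentiable, in
    particular continuous, at [0], so the mean value argument covers it. *)
Lemma within_derive_le0_nincr {R : realType} (f d : R -> R) :
  (forall t : R, 0 <= t -> has_derive_within `[0, +oo[ f t (d t)) ->
  (forall t : R, 0 <= t -> d t <= 0) ->
  forall t1 t : R, 0 <= t1 -> t1 <= t -> f t <= f t1.
Proof.
move=> fd d0 t1 t t10 t1t.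
have gd (s : R) : 0 <= s -> is_derive s 1 (extend_left f (d 0)) (d s).
  by move=> s0; apply: is_derive_extend_left => //; [move=> ->|exact: fd].
rewrite -(extend_leftE f (d 0) t1)// -(extend_leftE f (d 0) t) ?(le_trans t10)//.
apply: (@ler0_derive1_nincry _ _ 0) => //.
- move=> x; rewrite in_itv/= andbT => /ltW x0; have ? := gd _ x0; exact: ex_derive.
- move=> x; rewrite in_itv/= andbT => /ltW x0; have ? := gd _ x0.
  by rewrite derive1E derive_val d0.
- apply: derivable_within_continuous => x; rewrite in_itv/= andbT => x0.
  have ? := gd _ x0; exact: ex_derive.
Qed.

Lemma has_derive_within_sum_nat {R : realType} (D : set R) (m n : nat)
    (f : nat -> R -> R) (t : R) (l : nat -> R) :
  (forall j, (m <= j < n)%N -> has_derive_within D (f j) t (l j)) ->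
  has_derive_within D (fun s => \sum_(m <= j < n) f j s) t (\sum_(m <= j < n) l j).
Proof.
move=> fl; rewrite /has_derive_within.
have -> : diff_quot (fun s => \sum_(m <= j < n) f j s) t =
    (fun s => \sum_(m <= j < n | (m <= j < n)%N) diff_quot (f j) t s).
  by apply/funext => s; rewrite /diff_quot -sumrB scaler_sumr big_nat.
by rewrite [X in _ --> X]big_nat; apply: cvg_big => //; exact: add_continuous.
Qed.

Lemma has_derive_within_lin {R : realType} (D : set R) (f g : R -> R) (a b t l m : R) :
  has_derive_within D f t l -> has_derive_within D g t m ->
  has_derive_within D (fun s => a * f s + b * g s) t (a * l + b * m).
Proof.
move=> fl gm; rewrite /has_derive_within.
have -> : diff_quot (fun s => a * f s + b * g s) t =
    (fun s => a * diff_quot f t s + b * diff_quot g t s).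
  by apply/funext => s; rewrite /diff_quot /GRing.scale /=; ring.
by apply: cvgD; apply: cvgMr.
Qed.

(** Nonnegative times accumulate at [t] from the right, so the limit of the
    difference quotients is determined. *)
Lemma has_derive_within_unique {R : realType} (f : R -> R) (t l m : R) :
  0 <= t -> has_derive_within `[0, +oo[ f t l ->
  has_derive_within `[0, +oo[ f t m -> l = m.
Proof.
move=> t0.
have right k : has_derive_within `[0, +oo[ f t k -> diff_quot f t @ t^'+ --> k.
  move=> fk A Ak.
  have h : \forall s \near t, s != t -> `[0, +oo[%classic s -> A (diff_quot f t s).
    exact: fk.
  suff : \forall s \near t, t < s -> A (diff_quot f t s) by [].
  apply: filterS h => s h ts; apply: h; first by rewrite gt_eqF.
  by rewrite /= in_itv /= andbT (le_trans t0) ?ltW.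
by move=> /right fl /right fm; exact: cvg_unique fl fm.
Qed.

Lemma has_derive_within_coord {R : realType} (D : set R) (f : R -> 'cV[R]_2) (t : R) i :
  derivable_within D f t ->
  has_derive_within D (fun s => f s i 0) t (derive_within D f t i 0).
Proof.
move=> df; rewrite /has_derive_within.
have -> : diff_quot (fun s => f s i 0) t = (fun M : 'cV[R]_2 => M i 0) \o diff_quot f t.
  by apply/funext => s; rewrite /diff_quot /= !mxE.
exact: (cvg_comp _ _ df (@coord_continuous _ _ _ i 0 _)).
Qed.

Lemma has_derive_within_mul {R : realType} (f g : R -> R) (t l m : R) :
  0 <= t -> has_derive_within `[0, +oo[ f t l -> has_derive_within `[0, +oo[ g t m ->
  has_derive_within `[0, +oo[ (fun s => f s * g s) t (f t * m + g t * l).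
Proof.
move=> t0 fl gm.
have df := is_derive_extend_left f l t l t0 (fun=> erefl) fl.
have dg := is_derive_extend_left g m t m t0 (fun=> erefl) gm.
apply: (has_derive_within_congr _ _ (extend_left f l * extend_left g m)).
- apply: has_derive_within_is_derive; apply: (is_derive_eq (is_deriveM df dg)).
  by rewrite !extend_leftE.
- by rewrite /= [RHS]/GRing.mul/= !extend_leftE.
- by near=> s; rewrite /= in_itv/= andbT => s0; rewrite [RHS]/GRing.mul/= !extend_leftE.
Unshelve. all: by end_near. Qed.

(** * The periodic extension of a function of the angle *)

(** The [2 pi]-periodic extension of [gamma] from [[-pi, pi]], valid up to
    [3 pi] in absolute value; this is enough for an angle of [[-pi, pi]] modified
    by less than [pi / 2]. *)
Definition wrap_angle {R : realType} (gamma : R -> R) (x : R) : R :=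
  if x < - pi then gamma (x + pi *+ 2)
  else if pi < x then gamma (x - pi *+ 2) else gamma x.

Lemma wrap_angleE {R : realType} (gamma : R -> R) (x : R) :
  x \in `[- pi, pi] -> wrap_angle gamma x = gamma x.
Proof.
by rewrite in_itv/= /wrap_angle => /andP[x1 x2]; rewrite !ltNge x1 x2.
Qed.

(** At [pi] the extension is [gamma] on the left and the translate of [gamma]
    near [-pi] on the right, and the matching conditions make the two one-sided
    derivatives equal; likewise at [-pi]. *)
Lemma is_derive_wrap_angle {R : realType} (gamma : R -> R) (x : R) :
  (forall y : R, y \in `[- pi, pi] -> derivable_within `[- pi, pi] gamma y) ->
  gamma (- pi) = gamma pi ->
  derive_within `[- pi, pi] gamma (- pi) = derive_within `[- pi, pi] gamma pi ->
  x \in `[- pi, pi] ->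
  is_derive x 1 (wrap_angle gamma) (derive_within `[- pi, pi] gamma x).
Proof.
move=> dg per per' xpi; have pi0 : 0 < pi :> R := pi_gt0 R.
set D : set R := `[- pi, pi]%classic.
rewrite -/D in per'.
have inner : has_derive_within D (wrap_angle gamma) x (derive_within D gamma x).
  apply: (has_derive_within_congr _ _ gamma _ _
    (derivable_within_has_derive _ _ _ (dg _ xpi))); first exact: wrap_angleE.
  by near=> s => Ds; rewrite wrap_angleE.
have pimem : pi \in `[- pi, pi : R] by rewrite in_itv /=; lra.
have Npimem : - pi \in `[- pi, pi : R] by rewrite in_itv /=; lra.
have [/andP[x1 x2]|] := boolP (- pi < x < pi).
  apply: (is_derive_glue _ _ _ _ _ inner inner); near=> s; left.
  rewrite /D /= in_itv /=; apply/andP; split; apply: ltW; near: s.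
    exact: lt_nbhsr.
  exact: lt_nbhsl.
rewrite negb_and -!leNgt => xout; move: xpi; rewrite in_itv/= => /andP[x1 x2].
have {x1 x2 xout} [xE|xE] : x = pi \/ x = - pi by case/orP: xout => ?; lra.
  rewrite {}xE in inner *.
  apply: (is_derive_glue D [set s | D (s - pi *+ 2)] _ _ _ inner).
    have piE : pi - pi *+ 2 = - pi :> R by rewrite mulr2n; ring.
    have := has_derive_within_shift D gamma (pi *+ 2) pi.
    rewrite piE => /(_ _ (derivable_within_has_derive _ _ _ (dg _ Npimem))); rewrite per'.
    move/has_derive_within_congr; apply.
      by rewrite wrap_angleE//= piE.
    near=> s; rewrite /D /= in_itv /= => /andP[s1 s2]; rewrite /wrap_angle.
    case: ltP => [sp|_]; first by lra.
    case: ltP => // sp; have -> : s = pi by lra.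
    by rewrite piE.
  near=> s; have [sp|sp] := leP s pi; [left|right];
    rewrite /D /= in_itv /=; apply/andP; split => //; rewrite ?lerBrDr ?lerBlDr;
    apply: ltW.
  - by near: s; apply: lt_nbhsr; lra.
  - by rewrite (le_lt_trans _ sp)//; lra.
  - by near: s; apply: lt_nbhsl; lra.
rewrite {}xE in inner *.
apply: (is_derive_glue D [set s | D (s - - (pi *+ 2))] _ _ _ inner).
  have piE : - pi - - (pi *+ 2) = pi :> R by rewrite mulr2n; ring.
  have := has_derive_within_shift D gamma (- (pi *+ 2)) (- pi).
  rewrite piE => /(_ _ (derivable_within_has_derive _ _ _ (dg _ pimem))); rewrite -per'.
  move/has_derive_within_congr; apply.
    by rewrite wrap_angleE//= piE.
  near=> s; rewrite /D /= in_itv /= => /andP[s1 s2]; rewrite /wrap_angle.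
  case: ltP => [sp|]; first by rewrite opprK.
  case: ltP => sp sp'; first by lra.
  have -> : s = - pi by lra.
  by rewrite piE.
near=> s; have [sp|sp] := leP (- pi) s; [left|right];
  rewrite /D /= in_itv /=; apply/andP; split => //; apply: ltW.
- by near: s; apply: lt_nbhsl; lra.
- by rewrite ltrBrDr; near: s; apply: lt_nbhsr; lra.
- by lra.
Unshelve. all: by end_near. Qed.

(** The ends of [[-pi, pi]] are the only two angles there that name the same
    direction: equal cosines force [a = b] or [a = - b], and in the latter case
    equal sines force the common sine to vanish. *)
Lemma cos_sin_inj {R : realType} (a b : R) :
  a \in `[- pi, pi] -> b \in `[- pi, pi] -> cos a = cos b -> sin a = sin b ->
  a = b \/ (a = pi /\ b = - pi) \/ (a = - pi /\ b = pi).
Proof.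
wlog ab : a b / b <= a => [hw|].
  move=> ha hb c s; have [ab|/ltW ab] := leP b a; first exact: hw.
  by case: (hw b a ab hb ha (esym c) (esym s)) => [|[[]|[]]]; auto.
rewrite !in_itv /= => /andP[a1 a2] /andP[b1 b2] c s.
have [b0|/ltW b0] := leP 0 b.
  by left; apply: cos_inj => //; rewrite in_itv /=; apply/andP; split => //; lra.
have [a0|/ltW a0] := leP a 0.
  by left; apply: oppr_inj; apply: cos_inj; rewrite ?cosN// in_itv /=;
    apply/andP; split; lra.
have abN : a = - b.
  by apply: cos_inj; rewrite ?cosN// in_itv /=; apply/andP; split; lra.
have sa : sin a = 0 by move: s; rewrite -[b]opprK -abN sinN => ?; lra.
have [a_lt_pi|a_ge_pi] := ltP a pi; last by right; left; split; lra.
move: a0; rewrite le_eqVlt => /predU1P[a0|a0]; first by left; lra.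
by have := @sin_gt0_pi R a; rewrite a0 a_lt_pi sa ltxx => /(_ isT).
Qed.

(** The ambiguity between [-pi] and [pi] is harmless since [gamma] takes the same
    value there, so the extension depends on the direction only. *)
Lemma wrap_angle_eq {R : realType} (gamma : R -> R) (phi theta : R) :
  gamma (- pi) = gamma pi -> theta \in `[- pi, pi] ->
  - (pi *+ 3) <= phi <= pi *+ 3 ->
  cos phi = cos theta -> sin phi = sin theta ->
  wrap_angle gamma phi = gamma theta.
Proof.
move=> per th /andP[p1 p2] c s.
have key psi : psi \in `[- pi, pi] -> cos psi = cos theta -> sin psi = sin theta ->
    gamma psi = gamma theta.
  by move=> hpsi {}c {}s; case: (cos_sin_inj _ _ hpsi th c s) => [->|[[-> ->]|[-> ->]]].
rewrite /wrap_angle; case: ltP => h1.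
  by apply: key; rewrite ?cosD2pi ?sinD2pi// in_itv /=; apply/andP; split; lra.
case: ltP => h2; last by apply: key => //; rewrite in_itv /= h1 h2.
apply: key; rewrite ?in_itv /=; first by apply/andP; split; lra.
  by rewrite -cosD2pi subrK.
by rewrite -sinD2pi subrK.
Qed.

(** * The energy of a moving edge *)

Lemma sin_atan_cos {R : realType} (x : R) : sin (atan x) = x * cos (atan x).
Proof.
have := atanK x; rewrite /tan => /(congr1 (fun y => y * cos (atan x))) <-.
rewrite mulfVK// cos_atan invr_neq0// sqrtr_eq0 -ltNge.
by rewrite ltr_pwDl// sqr_ge0.
Qed.

(** The vector [(p, q)] is obtained from [(p0, q0)] by a rotation whose cosine and
    sine are [d / (r0 r)] and [c / (r0 r)], with [d] the scalar and [c] the cross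
    product; for [d > 0] the angle of this rotation is [atan (c / d)]. *)
Lemma cos_sin_rotated_angle {R : realType} (theta0 p0 q0 p q : R) :
  let r0 := Num.sqrt (p0 * p0 + q0 * q0) in
  let r := Num.sqrt (p * p + q * q) in
  let phi := theta0 + atan ((p0 * q - q0 * p) / (p0 * p + q0 * q)) in
  cos theta0 = p0 / r0 -> sin theta0 = q0 / r0 -> 0 < p0 * p + q0 * q ->
  cos phi = p / r /\ sin phi = q / r.
Proof.
move=> r0 r phi c0 s0; rewrite {}/phi.
set d := p0 * p + q0 * q; set c := p0 * q - q0 * p => d0.
have r0r0 : r0 * r0 = p0 * p0 + q0 * q0.
  by rewrite -expr2 sqr_sqrtr// addr_ge0// -expr2 sqr_ge0.
have rr : r * r = p * p + q * q.
  by rewrite -expr2 sqr_sqrtr// addr_ge0// -expr2 sqr_ge0.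
have r_ge0 : 0 <= r by exact: sqrtr_ge0.
have r0_ge0 : 0 <= r0 by exact: sqrtr_ge0.
(* Lagrange's identity. *)
have cd : r0 * r0 * (r * r) = c * c + d * d by rewrite r0r0 rr /c /d; ring.
have rn0 : r != 0.
  by apply/eqP => rE; move: cd; rewrite rE; clear -d0; move=> ?; nra.
have r0n0 : r0 != 0.
  by apply/eqP => rE; move: cd; rewrite rE; clear -d0; move=> ?; nra.
have dn0 : d != 0 by rewrite gt_eqF.
have cosE : cos (atan (c / d)) = d / (r0 * r).
  rewrite cos_atan (_ : 1 + _ = (r0 * r / d) ^+ 2).
    by rewrite sqrtr_sqr ger0_norm ?invf_div// divr_ge0 ?mulr_ge0// ltW.
  apply: (mulIf (mulf_neq0 dn0 dn0)); rewrite !expr2.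
  transitivity (c * c + d * d); first by field.
  by rewrite -cd; field.
have sinE : sin (atan (c / d)) = c / (r0 * r).
  by rewrite sin_atan_cos cosE; field; rewrite dn0 r0n0 rn0.
rewrite cosD sinD cosE sinE c0 s0; split; apply: (mulIf (mulf_neq0 (mulf_neq0 r0n0 r0n0) rn0)).
- transitivity (p0 * d - q0 * c); first by field; rewrite r0n0 rn0.
  transitivity (p * (r0 * r0)); last by field.
  by rewrite r0r0 /d /c; ring.
- transitivity (q0 * d + p0 * c); first by field; rewrite r0n0 rn0.
  transitivity (q * (r0 * r0)); last by field.
  by rewrite r0r0 /d /c; ring.
Qed.

(** Near [t] the edge keeps a positive scalar product with its value at [t], and
    [theta] may be replaced by the angle [phi] measured from [theta t], which is
    differentiable in [s] even when [theta] jumps. *)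
Lemma has_derive_within_edge_energy {R : realType} (gamma : R -> R) (D : set R)
    (p q theta : R -> R) (t dp dq : R) :
  (forall y : R, y \in `[- pi, pi] -> derivable_within `[- pi, pi] gamma y) ->
  gamma (- pi) = gamma pi ->
  derive_within `[- pi, pi] gamma (- pi) = derive_within `[- pi, pi] gamma pi ->
  is_derive t 1 p dp -> is_derive t 1 q dq -> D t ->
  let r s := Num.sqrt (p s * p s + q s * q s) in
  0 < r t ->
  (forall s, D s -> [/\ theta s \in `[- pi, pi], cos (theta s) = p s / r s
    & sin (theta s) = q s / r s]) ->
  has_derive_within D (fun s => r s * gamma (theta s)) t
    ((gamma (theta t) * (p t * dp + q t * dq)
      + derive_within `[- pi, pi] gamma (theta t) * (p t * dq - q t * dp)) / r t).
Proof.
move=> dg per per' pd qd Dt r r0 ang.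
have rr0 : 0 < p t * p t + q t * q t by rewrite -sqrtr_gt0.
have rtrt : r t * r t = p t * p t + q t * q t by rewrite -expr2 sqr_sqrtr// ltW.
have [tht ct st] := ang _ Dt.
pose phi s := theta t +
  atan ((p t * q s - q t * p s) / (p t * p s + q t * q s)).
have phit : phi t = theta t by rewrite /phi [q t * p t]mulrC subrr mul0r atan0 addr0.
(* The cross product vanishes at [t], so only its derivative contributes. *)
have dphi : is_derive t 1 phi ((p t * dq - q t * dp) / (r t * r t)).
  have h1 : is_derive t 1 (fun s => p t * q s - q t * p s) (p t * dq - q t * dp).
    exact: (is_deriveB (is_deriveZ (p t) qd) (is_deriveZ (q t) pd)).
  have h2 : is_derive t 1 (fun s => p t * p s + q t * q s) (p t * dp + q t * dq).
    exact: (is_deriveD (is_deriveZ (p t) pd) (is_deriveZ (q t) qd)).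
  have h3 := @is_deriveV R (fun s => p t * p s + q t * q s) t _ _ (lt0r_neq0 rr0) h2.
  have h4 := is_deriveM h1 h3.
  have h5 := @is_derive1_comp R atan _ t _ _ (is_derive1_atan _) h4.
  have h6 := is_deriveD (is_derive_cst (theta t) t 1) h5.
  apply: (is_derive_eq h6); rewrite add0r /GRing.scale /=.
  rewrite rtrt.
  rewrite [(_ * _) t]/GRing.mul /= [q t * p t]mulrC subrr !mul0r expr0n/= addr0.
  by field; rewrite gt_eqF.
have dwrap := is_derive_wrap_angle gamma (theta t) dg per per' tht.
apply: (has_derive_within_congr _ _ (fun s => r s * wrap_angle gamma (phi s))).
- apply: has_derive_within_is_derive.
  have drr : is_derive t 1 (fun s => p s * p s + q s * q s)
      (2 * (p t * dp + q t * dq)).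
    apply: (is_derive_eq (is_deriveD (is_deriveM pd pd) (is_deriveM qd qd))).
    by rewrite /GRing.scale /=; ring.
  have dr : is_derive t 1 r ((p t * dp + q t * dq) / r t).
    have dsq := is_derive1_sqrt rr0.
    have := @is_derive1_comp R Num.sqrt (fun s => p s * p s + q s * q s) t _ _ dsq drr.
    move=> h; apply: (is_derive_eq h); rewrite -/(r t).
    by field; rewrite gt_eqF.
  rewrite -phit in dwrap.
  have dw := is_derive1_comp dwrap dphi.
  apply: (is_derive_eq (is_deriveM dr dw)).
  rewrite /= phit wrap_angleE// /GRing.scale/=.
  by field; rewrite gt_eqF.
- by rewrite phit wrap_angleE.
- have dotc : (fun s => p t * p s + q t * q s) @ t --> p t * p t + q t * q t.
    have pc : p @ t --> p t by apply/differentiable_continuous/derivable1_diffP.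
    have qc : q @ t --> q t by apply/differentiable_continuous/derivable1_diffP.
    by apply: cvgD; apply: cvgMr.
  have dot0 : \forall s \near t, 0 < p t * p s + q t * q s by exact: (cvgr_gt _ dotc).
  apply: filterS dot0 => s ds Ds.
  have [ths cs ss] := ang _ Ds.
  have [cphi sphi] := cos_sin_rotated_angle _ _ _ _ _ ct st ds.
  congr (_ * _); apply/esym/wrap_angle_eq => //.
  + have /andP[t1 t2] : - pi <= theta t <= pi by move: tht; rewrite in_itv.
    have := @atan_gtNpi2 R ((p t * q s - q t * p s) / (p t * p s + q t * q s)).
    have := @atan_ltpi2 R ((p t * q s - q t * p s) / (p t * p s + q t * q s)).
    have := pi_gt0 R; rewrite /phi => *; apply/andP; split; lra.
  + by rewrite cs cphi.
  + by rewrite ss sphi.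
Qed.

(** * Piecewise affine functions and mass lumping *)

Lemma node_lt (R : realType) (N i j : nat) :
  (0 < N)%N -> (i < j)%N -> node R N i < node R N j.
Proof. by move=> N0 ij; rewrite /node ltr_pM2r ?ltr_nat// invr_gt0 ltr0n. Qed.

Lemma node_le (R : realType) (N i j : nat) :
  (0 < N)%N -> (i <= j)%N -> node R N i <= node R N j.
Proof. by move=> N0 ij; rewrite /node ler_pM2r ?ler_nat// invr_gt0 ltr0n. Qed.

Lemma node0 (R : realType) (N : nat) : node R N 0 = 0.
Proof. by rewrite /node mul0r. Qed.

Lemma nodeN (R : realType) (N : nat) : (0 < N)%N -> node R N N = 1.
Proof. by move=> N0; rewrite /node divff// pnatr_eq0 -lt0n. Qed.

Lemma node_pred_lt (R : realType) (N j : nat) :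
  (1 <= j <= N)%N -> node R N j.-1 < node R N j.
Proof. by case: j => // j jN; apply: node_lt; case: N jN. Qed.

Lemma node_in01 (R : realType) (N j : nat) :
  (0 < N)%N -> (j <= N)%N -> node R N j \in `[0, 1].
Proof. by move=> N0 jN; rewrite in_itv /= -(node0 R N) -(nodeN R N N0) !node_le. Qed.

(** The coefficients depend on [r] only: this is what makes interpolation commute
    with time derivatives. *)
Lemma Khp_interp (R : realType) (N j : nat) (u : R -> R) (r : R) :
  Khp N u -> (1 <= j <= N)%N -> r \in `[node R N j.-1, node R N j] ->
  u r = (j%:R - N%:R * r) * u (node R N j.-1)
        + (N%:R * r - j.-1%:R) * u (node R N j).
Proof.
move=> [_ aff _] jN rj; have [a [b ab]] := aff _ jN.
have lt := node_pred_lt R N j jN.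
rewrite !ab ?in_itv/= ?lexx ?(ltW lt)// /node.
case: j jN {rj lt ab} => // j jN.
have N0 : N%:R != 0 :> R by rewrite pnatr_eq0; case: N jN {aff}.
by rewrite /= -natr1; field.
Qed.

(** Adjacent elements share their common node, so the pieces agree there and
    can be glued along closed intervals. *)
Lemma piecewise_affine_continuous (R : realType) (N : nat) (u : R -> R) :
  (0 < N)%N ->
  (forall j, (1 <= j <= N)%N -> exists a b : R,
     forall r, r \in `[node R N j.-1, node R N j] -> u r = a * r + b) ->
  {within `[0, 1], continuous u}.
Proof.
move=> N0 aff.
have cont j : (1 <= j <= N)%N ->
    {within `[node R N j.-1, node R N j], continuous u}.
  move=> jN; have [a [b ab]] := aff _ jN.
  apply: (@subspace_eq_continuous _ _ _ (fun r => a * r + b)).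
    by move=> r; rewrite inE => rj; exact/esym/ab.
  apply: continuous_subspaceT => r.
  apply: cvgD; last exact: cvg_cst.
  by apply: cvgMr; exact: cvg_id.
suff : forall j, (1 <= j <= N)%N -> {within `[0, node R N j], continuous u}.
  by move=> /(_ N); rewrite N0 leqnn nodeN//; apply.
elim=> // -[_ _|j IH jN]; first by have := cont 1%N; rewrite N0 /= node0; apply.
have -> : `[0, node R N j.+2]%classic =
    `[0, node R N j.+1]%classic `|` `[node R N j.+1, node R N j.+2]%classic.
  have h1 : 0 <= node R N j.+1 by rewrite -(node0 R N) node_le.
  have h2 : node R N j.+1 <= node R N j.+2 by rewrite node_le.
  apply/seteqP; split=> r /=; rewrite !in_itv /=; last by case=> /andP[]; lra.
  move=> /andP[r0 r1]; have [?|/ltW ?] := leP r (node R N j.+1).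
    by left; apply/andP.
  by right; apply/andP.
apply: withinU_continuous; try exact: itv_closed.
  by apply: IH; rewrite (ltnW jN).
exact (cont j.+2 jN).
Qed.

(** The velocity of a moving finite element function is again one, so that it can
    serve as a test function. *)
Lemma Khp_derive (R : realType) (N : nat) (u : R -> R -> R) (d : R -> R) (t : R) :
  (0 < N)%N -> 0 <= t -> (forall s, 0 <= s -> Khp N (u s)) ->
  (forall r, r \in `[0, 1] -> has_derive_within `[0, +oo[ (fun s => u s r) t (d r)) ->
  Khp N d.
Proof.
move=> N0 t0 uK ud.
have in01 j r : (1 <= j <= N)%N -> r \in `[node R N j.-1, node R N j] -> r \in `[0, 1].
  move=> /andP[j1 jN]; rewrite !in_itv /= => /andP[r1 r2].
  rewrite (le_trans _ r1) -?(node0 R N) ?node_le//=.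
  by rewrite (le_trans r2)// -(nodeN R N N0) node_le.
have aff j : (1 <= j <= N)%N -> exists a b : R,
    forall r, r \in `[node R N j.-1, node R N j] -> d r = a * r + b.
  move=> jN; have [j1 jN'] := andP jN.
  pose d0 := d (node R N j.-1); pose d1 := d (node R N j).
  exists (N%:R * (d1 - d0)), (j%:R * d0 - j.-1%:R * d1) => r rj.
  transitivity ((j%:R - N%:R * r) * d0 + (N%:R * r - j.-1%:R) * d1); last by ring.
  apply: (has_derive_within_unique _ _ _ _ t0 (ud r (in01 _ _ jN rj))).
  apply: (has_derive_within_congr _ _ _ _ _ (has_derive_within_lin _ _ _ _ _ _ _ _
    (ud _ (node_in01 _ _ _ N0 (leq_trans (leq_pred _) jN')))
    (ud _ (node_in01 _ _ _ N0 jN')))).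
    by apply: Khp_interp => //; exact: uK.
  near=> s; rewrite /= in_itv /= andbT => s0; apply: Khp_interp => //; exact: uK.
split => //; first exact: piecewise_affine_continuous aff.
have h0 : 0 \in `[0, 1 : R] by rewrite in_itv /= lexx ler01.
have h1 : 1 \in `[0, 1 : R] by rewrite in_itv /= lexx ler01.
apply: (has_derive_within_unique _ _ _ _ t0 (ud 0 h0)).
apply: (has_derive_within_congr _ _ _ _ _ (ud 1 h1)); first by have [] := uK _ t0.
by near=> s; rewrite /= in_itv /= andbT => s0; have [] := uK _ s0.
Unshelve. all: by end_near. Qed.

Lemma Khp_cvg (R : realType) (N j : nat) (u : R -> R) :
  Khp N u -> (1 <= j <= N)%N ->
  u @ (node R N j)^'- --> u (node R N j) /\
  u @ (node R N j.-1)^'+ --> u (node R N j.-1).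
Proof.
move=> [_ aff _] jN; have [a [b ab]] := aff _ jN.
have lt := node_pred_lt R N j jN.
have c x : (fun r => a * r + b) @ x --> a * x + b.
  apply: cvgD; last exact: cvg_cst.
  by apply: cvgMr; exact: cvg_id.
split; rewrite ab ?in_itv/= ?lexx ?(ltW lt)//.
  apply: cvg_trans (cvg_within_filter _ (c _)); apply: near_eq_cvg; near=> r.
  by rewrite ab// in_itv /=; apply/andP; split; near: r;
    [exact: nbhs_left_ge|exact: nbhs_left_le].
apply: cvg_trans (cvg_within_filter _ (c _)); apply: near_eq_cvg; near=> r.
by rewrite ab// in_itv /=; apply/andP; split; near: r;
  [exact: nbhs_right_ge|exact: nbhs_right_le].
Unshelve. all: by end_near. Qed.

Lemma pwconstE (R : realType) (N j : nat) (T : Type) (c : nat -> T) (r : R) :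
  (1 <= j <= N)%N -> node R N j.-1 < r < node R N j -> pwconst N c r = c j.
Proof.
case: j => // j jN /andP[r1 r2]; rewrite /pwconst; congr (c _.+1); apply/eqP.
have N0 : 0 < N%:R :> R by rewrite ltr0n; case: N jN {r1 r2}.
move: r1 r2; rewrite /node ltr_pdivrMr// ltr_pdivlMr// [r * _]mulrC => /= r1 r2.
rewrite truncn_eq; first by rewrite (ltW r1) r2.
by rewrite (le_trans _ (ltW r1)).
Qed.

Lemma pwconst_cvg (R : realType) (N j : nat) (c : nat -> R) :
  (1 <= j <= N)%N ->
  (pwconst N c : R -> R) @ (node R N j)^'- --> c j /\
  (pwconst N c : R -> R) @ (node R N j.-1)^'+ --> c j.
Proof.
move=> jN; have lt := node_pred_lt R N j jN.
split; apply: cvg_near_cst; near=> r;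
  apply: (pwconstE _ _ _ _ _ _ jN); apply/andP; split; near: r.
- exact: nbhs_left_gt.
- exact: nbhs_left_lt.
- exact: nbhs_right_gt.
- exact: nbhs_right_lt.
Unshelve. all: by end_near. Qed.

Lemma lumped_cvg (R : realType) (N : nat) (len : nat -> R) (p : R -> R)
    (pl pr : nat -> R) :
  (forall j, (1 <= j <= N)%N ->
     p @ (node R N j)^'- --> pl j /\ p @ (node R N j.-1)^'+ --> pr j) ->
  lumped N len p = 2^-1 * \sum_(1 <= j < N.+1) len j * (pl j + pr j).
Proof.
move=> plr; rewrite /lumped; congr (_ * _); apply: eq_big_nat => j.
rewrite ltnS => jN; have [hl hr] := plr _ jN.
by rewrite (cvg_lim _ hl)// (cvg_lim _ hr).
Qed.

Lemma lumped_pwconst (R : realType) (N : nat) (len c : nat -> R) :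
  lumped N len (pwconst N c) = \sum_(1 <= j < N.+1) len j * c j.
Proof.
rewrite (lumped_cvg _ _ _ _ c c); last by move=> j; exact: pwconst_cvg.
by rewrite mulr_sumr; apply: eq_bigr => j _; field.
Qed.

Lemma dotE (R : realType) (u v : 'cV[R]_2) :
  dot u v = u 0 0 * v 0 0 + u 1 0 * v 1 0.
Proof.
by rewrite /dot big_ord_recl big_ord1; congr (_ + _ * _); congr (_ _ _); apply/val_inj.
Qed.

(** * Consequences of the scheme at a fixed time *)

Definition cross {R : realType} (u v : 'cV[R]_2) : R := u 0 0 * v 1 0 - u 1 0 * v 0 0.

Lemma sum_node_telescope (R : zmodType) (N : nat) (f : nat -> R) :
  \sum_(1 <= j < N.+1) (f j - f j.-1) = f N - f 0%N.
Proof. by rewrite big_add1 /= telescope_sumr. Qed.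

(** The test function [1] kills the term in [mu]. As the normal is the edge turned
    by a right angle and divided by its length, the weight [len j] clears the
    denominator and leaves a cross product with twice the mean velocity of the
    edge. *)
Lemma scheme_flux_eq0 (R : realType) (N : nat) (gamma : R -> R)
    (X dX : R -> 'cV[R]_2) (mu : R -> R) (theta : nat -> R) :
  (forall j, (1 <= j <= N)%N -> 0 < edge_len N X j) ->
  Xhp N dX -> semi_discrete N gamma X dX mu theta ->
  2^-1 * \sum_(1 <= j < N.+1)
    cross (edge N X j) (dX (node R N j) + dX (node R N j.-1)) = 0.
Proof.
move=> len0 dXK [eq1 _].
have K1 : Khp N (fun=> 1 : R).
  split=> //; first by apply: continuous_subspaceT => r; exact: cvg_cst.
  by move=> j _; exists 0, 1 => r _; rewrite mul0r add0r.
have := eq1 _ K1.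
have -> : lumped_scal N (edge_len N X) (ds N (edge_len N X) mu)
    (ds N (edge_len N X) (fun=> 1)) = 0.
  rewrite /lumped_scal (_ : (fun r => _) = (pwconst N (fun=> 0 : R))).
    by rewrite lumped_pwconst big1// => j _; rewrite mulr0.
  by apply/funext => r; rewrite {2}/ds /pwconst subrr scaler0 mulr0.
rewrite addr0 => eq0; apply: etrans eq0; pose n := normal N X; pose d j := dX (node R N j).
rewrite /lumped_vec (lumped_cvg _ _ _ _
    (fun j => d j 0 0 * n j 0 0 + d j 1 0 * n j 1 0)
    (fun j => d j.-1 0 0 * n j 0 0 + d j.-1 1 0 * n j 1 0)); last first.
  move=> j jN.
  have -> : (fun r => dot (dX r) (1 *: pwconst N n r)) =
      (fun r => dX r 0 0 * pwconst N (fun j => n j 0 0) r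
                + dX r 1 0 * pwconst N (fun j => n j 1 0) r).
    by apply/funext => r; rewrite scale1r dotE.
  have [l0 r0] := Khp_cvg _ _ _ _ (dXK 0) jN.
  have [l1 r1] := Khp_cvg _ _ _ _ (dXK 1) jN.
  have [nl0 nr0] := pwconst_cvg _ _ _ (fun j => n j 0 0) jN.
  have [nl1 nr1] := pwconst_cvg _ _ _ (fun j => n j 1 0) jN.
  by split; apply: cvgD; apply: cvgM.
congr (_ * _); apply: eq_big_nat => j; rewrite ltnS => jN.
have ln : edge_len N X j != 0 by rewrite gt_eqF// len0.
rewrite /n /normal /perp /cross /d !mxE /=.
by field.
Qed.

(** Testing with [mu] and with the velocity makes both equations contain
    [(mu, n . dX)], and what remains after eliminating it is the lumped square
    of [ds mu]. All factors being constant on elements, the lumped products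
    reduce to plain sums over the edges. *)
Lemma scheme_dissipation (R : realType) (N : nat) (gamma : R -> R)
    (X dX : R -> 'cV[R]_2) (mu : R -> R) (theta : nat -> R) :
  (forall j, (1 <= j <= N)%N -> 0 < edge_len N X j) ->
  Khp N mu -> Xhp N dX -> semi_discrete N gamma X dX mu theta ->
  \sum_(1 <= j < N.+1)
    (gamma (theta j) * dot (edge N X j) (edge N dX j)
     + derive_within `[- pi, pi] gamma (theta j) * cross (edge N X j) (edge N dX j))
    / edge_len N X j <= 0.
Proof.
move=> len0 muK dXK [eq1 eq2].
have {}eq1 := eq1 _ muK; have {}eq2 := eq2 _ dXK.
set len := edge_len N X in eq1 eq2 *.
have sym : lumped_vec N len dX (fun r => mu r *: pwconst N (normal N X) r) =
    lumped_scal N len mu (fun r => dot (pwconst N (normal N X) r) (dX r)).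
  by congr (lumped _ _ _); apply/funext => r; rewrite !dotE !mxE; ring.
have diss : 0 <= lumped_scal N len (ds N len mu) (ds N len mu).
  rewrite /lumped_scal (_ : (fun r => _) = pwconst N
    (fun j => ((len j)^-1 *: (mu (node R N j) - mu (node R N j.-1))) ^+ 2)) //.
  rewrite lumped_pwconst big_nat_cond; apply: sumr_ge0 => j.
  by rewrite andbT ltnS => jN; rewrite mulr_ge0 ?sqr_ge0// ltW// len0.
rewrite (_ : \sum_(_ <= _ < _) _ = lumped_vec N len
   (fun r => pwconst N (fun j => Gmat gamma (theta j)) r *m ds N len X r)
   (ds N len dX)); first by rewrite sym in eq1; lra.
transitivity (lumped N len (pwconst N (fun j => dot
   (Gmat gamma (theta j) *m ((len j)^-1 *: (X (node R N j) - X (node R N j.-1))))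
   ((len j)^-1 *: (dX (node R N j) - dX (node R N j.-1)))))) => //.
rewrite lumped_pwconst; apply: eq_big_nat => j; rewrite ltnS => jN.
have ln : len j != 0 by rewrite gt_eqF// len0.
rewrite !dotE /cross /edge !mxE !big_ord_recl !big_ord0 !mxE /=.
rewrite (_ : lift ord0 ord0 = 1); last exact/val_inj.
set dgam := derive_within _ _ _.
by field.
Qed.

(** * Time derivatives of the area and of the energy *)

Lemma has_derive_within_edge (R : realType) (N j : nat) (X : R -> R -> 'cV[R]_2)
    (V : R -> 'cV[R]_2) (t : R) (i : 'I_2) :
  (forall k i, (k <= N)%N ->
     has_derive_within `[0, +oo[ (fun s => X s (node R N k) i 0) t (V (node R N k) i 0)) ->
  (1 <= j <= N)%N ->
  has_derive_within `[0, +oo[ (fun s => edge N (X s) j i 0) t (edge N V j i 0).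
Proof.
move=> XV /andP[j1 jN]; have j'N := leq_trans (leq_pred j) jN.
have := has_derive_within_lin _ _ _ 1 (-1) _ _ _ (XV j i jN) (XV _ i j'N).
rewrite !mul1r !mulN1r /edge !mxE; move/has_derive_within_congr; apply.
  by rewrite !mxE mul1r mulN1r.
by near=> s; rewrite !mxE mul1r mulN1r.
Unshelve. all: by end_near. Qed.

(** The derivative of each term of the area differs from the cross product by
    [2 (x'_j y_j - x'_{j-1} y_{j-1})], which telescopes to [0] around a closed
    polygon. *)
Lemma has_derive_within_area (R : realType) (N : nat) (X : R -> R -> 'cV[R]_2)
    (V : R -> 'cV[R]_2) (t : R) :
  (0 < N)%N -> 0 <= t ->
  (forall k i, (k <= N)%N ->
     has_derive_within `[0, +oo[ (fun s => X s (node R N k) i 0) t (V (node R N k) i 0)) ->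
  X t 0 = X t 1 -> V 0 = V 1 ->
  has_derive_within `[0, +oo[ (fun s => area N (X s)) t
    (2^-1 * \sum_(1 <= j < N.+1)
       cross (edge N (X t) j) (V (node R N j) + V (node R N j.-1))).
Proof.
move=> N0 t0 XV X01 V01.
pose x j i s := X s (node R N j) i 0; pose v j i := V (node R N j) i 0.
pose rate j := (x j 0 t - x j.-1 0 t) * (v j 1 + v j.-1 1)
             + (x j 1 t + x j.-1 1 t) * (v j 0 - v j.-1 0).
have rate_sum : \sum_(1 <= j < N.+1) rate j = \sum_(1 <= j < N.+1)
    cross (edge N (X t) j) (V (node R N j) + V (node R N j.-1)).
  apply/eqP; rewrite -subr_eq0 -sumrB; apply/eqP.
  transitivity (\sum_(1 <= j < N.+1)
      (2 * (v j 0 * x j 1 t) - 2 * (v j.-1 0 * x j.-1 1 t))).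
    by apply: eq_bigr => j _; rewrite /rate /cross /edge !mxE /x /v; ring.
  rewrite (sum_node_telescope _ _ (fun j => 2 * (v j 0 * x j 1 t))) /x /v.
  by rewrite nodeN// node0 X01 V01 subrr.
rewrite -rate_sum.
have term j : (1 <= j < N.+1)%N -> has_derive_within `[0, +oo[
    (fun s => (1 * x j 0 s + -1 * x j.-1 0 s) * (1 * x j 1 s + 1 * x j.-1 1 s)) t (rate j).
  rewrite ltnS => /andP[j1 jN]; have j'N := leq_trans (leq_pred j) jN.
  have := has_derive_within_mul _ _ _ _ _ t0
    (has_derive_within_lin _ _ _ 1 (-1) _ _ _ (XV j 0 jN) (XV _ 0 j'N))
    (has_derive_within_lin _ _ _ 1 1 _ _ _ (XV j 1 jN) (XV _ 1 j'N)).
  by rewrite /rate !mul1r !mulN1r.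
have dsum := has_derive_within_sum_nat _ _ _ _ _ _ term.
have := has_derive_within_lin _ _ _ 2^-1 0 _ _ _ dsum dsum.
rewrite mul0r addr0; move/has_derive_within_congr; apply; last near=> s => _.
all: rewrite mul0r addr0; congr (_ * _); apply: eq_bigr => j _.
all: by rewrite !mul1r mulN1r.
Unshelve. all: by end_near. Qed.

(** Each edge is extended to negative times by its tangent line before the
    two-sided calculus of [has_derive_within_edge_energy] is applied. *)
Lemma has_derive_within_energy (R : realType) (N : nat) (gamma : R -> R)
    (X : R -> R -> 'cV[R]_2) (V : R -> 'cV[R]_2) (theta : R -> nat -> R) (t : R) :
  (forall y : R, y \in `[- pi, pi] -> derivable_within `[- pi, pi] gamma y) ->
  gamma (- pi) = gamma pi ->
  derive_within `[- pi, pi] gamma (- pi) = derive_within `[- pi, pi] gamma pi ->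
  0 <= t ->
  (forall k i, (k <= N)%N ->
     has_derive_within `[0, +oo[ (fun s => X s (node R N k) i 0) t (V (node R N k) i 0)) ->
  (forall j, (1 <= j <= N)%N -> 0 < edge_len N (X t) j) ->
  (forall s j, 0 <= s -> (1 <= j <= N)%N -> is_angle N (X s) j (theta s j)) ->
  has_derive_within `[0, +oo[ (fun s => energy N (X s) gamma (theta s)) t
    (\sum_(1 <= j < N.+1)
      (gamma (theta t j) * dot (edge N (X t) j) (edge N V j)
       + derive_within `[- pi, pi] gamma (theta t j) * cross (edge N (X t) j) (edge N V j))
      / edge_len N (X t) j).
Proof.
move=> dg per per' t0 XV len0 ang; apply: has_derive_within_sum_nat => j.
rewrite ltnS => jN.
have dp := has_derive_within_edge _ _ _ _ _ _ 0 XV jN.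
have dq := has_derive_within_edge _ _ _ _ _ _ 1 XV jN.
set e := fun i s => edge N (X s) j i 0.
pose p := extend_left (e 0) (edge N V j 0 0).
pose q := extend_left (e 1) (edge N V j 1 0).
have pE s : 0 <= s -> p s = e 0 s by move=> ?; exact: extend_leftE.
have qE s : 0 <= s -> q s = e 1 s by move=> ?; exact: extend_leftE.
have lenE s : 0 <= s -> Num.sqrt (p s * p s + q s * q s) = edge_len N (X s) j.
  by move=> s0; rewrite pE// qE// /edge_len /enorm dotE.
have t_in : `[0, +oo[%classic t by rewrite /= in_itv /= t0.
have := has_derive_within_edge_energy gamma `[0, +oo[ p q (fun s => theta s j) t
  _ _ dg per per'
  (is_derive_extend_left _ _ _ _ t0 (fun=> erefl) dp)
  (is_derive_extend_left _ _ _ _ t0 (fun=> erefl) dq) t_in.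
rewrite /= lenE// pE// qE// => /(_ (len0 _ jN)) h.
have /h {}h : forall s, `[0, +oo[%classic s -> [/\ theta s j \in `[- pi, pi],
    cos (theta s j) = p s / Num.sqrt (p s * p s + q s * q s)
  & sin (theta s j) = q s / Num.sqrt (p s * p s + q s * q s)].
  move=> s; rewrite /= in_itv /= andbT => s0; rewrite lenE// pE// qE//.
  exact: ang.
rewrite dotE; apply: (has_derive_within_congr _ _ _ _ _ h); first by rewrite lenE.
by near=> s; rewrite /= in_itv /= andbT => s0; rewrite lenE.
Unshelve. all: by end_near. Qed.

(** * Conservation of area and decay of energy *)

Theorem proposition3p1 (R : realType) (gamma : R -> R)
    (hC1 : C1_on (- pi) pi gamma)
    (hpos : forall x, x \in `[- pi, pi] -> 0 < gamma x)
    (hper : gamma (- pi) = gamma pi)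
    (hper' : derive_within `[- pi, pi] gamma (- pi)
             = derive_within `[- pi, pi] gamma pi)
    (N : nat) (hN : (2 < N)%N)
    (L0 : R) (hL0 : 0 < L0) (X0 : R -> 'cV[R]_2) (hX0 : X0 0 = X0 L0)
    (X : R -> R -> 'cV[R]_2) (mu : R -> R -> R) (theta : R -> nat -> R)
    (hX : forall t, 0 <= t -> Xhp N (X t))
    (hmu : forall t, 0 <= t -> Khp N (mu t))
    (hdiff : forall t r, 0 <= t -> r \in `[0, 1] ->
       derivable_within `[0, +oo[ (fun s => X s r) t)
    (hedge : forall t j, 0 <= t -> (1 <= j <= N)%N -> 0 < edge_len N (X t) j)
    (htheta : forall t j, 0 <= t -> (1 <= j <= N)%N ->
       is_angle N (X t) j (theta t j))
    (hsol : forall t, 0 <= t ->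
       semi_discrete N gamma (X t)
         (fun r => derive_within `[0, +oo[ (fun s => X s r) t)
         (mu t) (theta t))
    (hinit : forall j, (j <= N)%N -> X 0 (node R N j) = X0 (L0 * node R N j)) :
  let A t := area N (X t) in
  let W t := energy N (X t) gamma (theta t) in
  let s0 j := L0 * node R N j in
  [/\ forall t, 0 <= t -> A t = A 0,
      A 0 = 2^-1 * \sum_(1 <= j < N.+1)
        (X0 (s0 j) 0 0 - X0 (s0 j.-1) 0 0) * (X0 (s0 j) 1 0 + X0 (s0 j.-1) 1 0),
      forall t1 t, 0 <= t1 -> t1 <= t -> W t <= W t1 /\ W t1 <= W 0
    & W 0 = \sum_(1 <= j < N.+1) edge_len N (X 0) j * gamma (theta 0 j)].
Proof.
move=> A W s0.
have N0 : (0 < N)%N by rewrite (leq_trans _ hN).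
pose D t r := derive_within `[0, +oo[ (fun s => X s r) t.
have XD t k i : 0 <= t -> (k <= N)%N -> has_derive_within `[0, +oo[
    (fun s => X s (node R N k) i 0) t (D t (node R N k) i 0).
  move=> t0 kN; apply: has_derive_within_coord; apply: hdiff => //.
  exact: node_in01.
have DX t : 0 <= t -> Xhp N (D t).
  move=> t0 i; apply: (Khp_derive _ _ (fun s r => X s r i 0) _ t) => //.
    by move=> s s0'; exact: hX.
  by move=> r r01; apply: has_derive_within_coord; exact: hdiff.
have periodic (w : R -> 'cV[R]_2) : Xhp N w -> w 0 = w 1.
  by move=> wX; apply/colP => i; have [] := wX i.
have dA t : 0 <= t -> has_derive_within `[0, +oo[ A t 0.
  move=> t0; have flux := scheme_flux_eq0 _ _ _ _ _ _ _
    (fun j => hedge t j t0) (DX t t0) (hsol t t0).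
  have := has_derive_within_area _ _ _ _ _ N0 t0 (fun k i => XD t k i t0)
    (periodic _ (hX t t0)) (periodic _ (DX t t0)).
  by rewrite flux.
have dW t (t0 : 0 <= t) := has_derive_within_energy _ _ _ _ _ _ _ hC1.1 hper hper' t0
  (fun k i => XD t k i t0) (fun j => hedge t j t0) htheta.
split.
- move=> t t0; apply/eqP; rewrite eq_le; apply/andP; split.
    by apply: (within_derive_le0_nincr A (fun=> 0)).
  rewrite -lerN2; apply: (within_derive_le0_nincr (fun s => - A s) (fun=> 0)) => //.
  move=> s s0'; have := has_derive_within_lin _ _ _ (-1) 0 _ _ _ (dA s s0') (dA s s0').
  rewrite !mulr0 addr0; move/has_derive_within_congr; apply.
    by rewrite mul0r addr0 mulN1r.
  by near=> u; rewrite mul0r addr0 mulN1r.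
- by rewrite /A /area; congr (_ * _); apply: eq_big_nat => j;
    rewrite ltnS => /andP[j1 jN]; rewrite !hinit// (leq_trans (leq_pred _)).
- have Wmono : forall t1 t : R, 0 <= t1 -> t1 <= t -> W t <= W t1.
    apply: (within_derive_le0_nincr _ _ dW) => t t0.
    exact: (scheme_dissipation _ _ _ _ _ _ _ (fun j => hedge t j t0)
      (hmu t t0) (DX t t0) (hsol t t0)).
  by move=> t1 t t10 t1t; split; apply: Wmono.
- by [].
Unshelve. all: by end_near. Qed.
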